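(* Let $p \ge 2$ be a prime and let $H$ be a $p$-uniform hypergraph on a finite vertex set $V$. If there is no continuous $\mathbb{Z}/p$-equivariant map $B(H) \to S^{2p-3}$, then for every $\mathbb{Z}/p$-coloring $c\colon V\to\mathbb{Z}/p$ of $H$ there is a hyperedge $e\in H$ with $\sum_{v\in e} c(v)=0$.
   Context: A $p$-uniform hypergraph $H$ on $V$ is a collection of $p$-element subsets of $V$ (hyperedges). The box complex $B(H)$ is the simplicial complex on vertex set $V\times\mathbb{Z}/p$ in which a subset $\sigma=\bigcup_{i\in\mathbb{Z}/p}(A_i\times\{i\})$ (with $A_i\subseteq V$) is a face if and only if $\{a_0,\dots,a_{p-1}\}\in H$ for all choices $a_0\in A_0,\dots,a_{p-1}\in A_{p-1}$. It is considered via its geometric realization, with the free $\mathbb{Z}/p$-action induced by $j\cdot(v,i)=(v,i+j)$ on vertices. The sphere $S^{2p-3}\subset\mathbb{C}^{p-1}\cong\mathbb{R}^{2p-2}$ carries the $\mathbb{Z}/p$-action in which the generator acts by $(z_1,\dots,z_{p-1})\mapsto(\omega z_1,\omega^2 z_2,\dots,\omega^{p-1}z_{p-1})$, where $\omega=e^{2\pi i/p}$ (i.e., the diagonal action by multiplication by all nontrivial $p$-th roots of unity). A map is equivariant if it commutes with these actions. *)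

(* Defs.v *)
From HB Require Import structures.
From mathcomp Require Import all_boot all_order all_algebra.
From mathcomp Require Import complex.
From mathcomp Require Import all_classical all_reals all_analysis.

Set Implicit Arguments.
Unset Strict Implicit.
Unset Printing Implicit Defensive.

Import Order.TTheory GRing.Theory Num.Theory.
Import numFieldNormedType.Exports.

Local Open Scope classical_set_scope.
Local Open Scope ring_scope.
Local Open Scope complex_scope.

(* Z/p is 'F_p, which has p elements because p is assumed prime in every use. *)

Definition uniform_hypergraph (p : nat) (V : finType) (H : {set {set V}}) :
  Prop := forall e : {set V}, e \in H -> #|e| = p.

(* A function a with (a i, i) \in s for all i is a choice of
   a_0 \in A_0, ..., a_(p-1) \in A_(p-1) where A_i = {v | (v, i) \in s};
   the condition is vacuous as soon as some A_i is empty. *)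
Definition box_complex (p : nat) (V : finType) (H : {set {set V}}) :
    {set {set V * 'F_p}} :=
  [set s : {set V * 'F_p} |
    [forall a : {ffun 'F_p -> V},
      [forall i, (a i, i) \in s] ==> ([set a i | i in 'F_p] \in H)]]%SET.

(* Geometric realization in barycentric coordinates.  T is finite, so the
   topology induced by the product topology on T -> R is the usual one. *)
Definition realization (R : realType) (T : finType) (K : {set {set T}}) :
    set {ptws T -> R} :=
  [set x | [/\ forall t, 0 <= x t, \sum_t x t = 1 &
             [set t | x t != 0]%SET \in K]].

Definition box_vertex_act (p : nat) (V : finType) (j : 'F_p) (u : V * 'F_p) :
  V * 'F_p := (u.1, u.2 + j).

(* The coordinate of j.x at the vertex u is that of x at (-j).u. *)
Definition box_act (R : realType) (p : nat) (V : finType) (j : 'F_p)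
    (x : {ptws V * 'F_p -> R}) : {ptws V * 'F_p -> R} :=
  fun u => x (box_vertex_act (- j) u).

Definition zp_omega (R : realType) (p : nat) : R[i] :=
  cos (2 * pi / p%:R) +i* sin (2 * pi / p%:R).

(* The Euclidean unit sphere of C^n = R^(2n); the library norm on row vectors is
   the sup norm.  The topology of C is found on R[i]^o, not on R[i] itself. *)
Definition complex_sphere (R : realType) (n : nat) : set 'rV[R[i]^o]_n :=
  [set z | \sum_(k < n) `|z ord0 k| ^+ 2 = 1].

(* Coordinates are numbered from 0, whence the exponent k.+1. *)
Definition sphere_act (R : realType) (p : nat) (j : 'F_p)
    (z : 'rV[R[i]^o]_p.-1) : 'rV[R[i]^o]_p.-1 :=
  \row_(k < p.-1) (zp_omega R p ^+ (k.+1 * j) * z ord0 k).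

(* Only the restriction of f to the realization matters. *)
Definition equivariant_map (R : realType) (p : nat) (V : finType)
    (H : {set {set V}}) (f : {ptws V * 'F_p -> R} -> 'rV[R[i]^o]_p.-1) : Prop :=
  let B := @realization R _ (box_complex p H) in
  [/\ {within B, continuous f},
      forall x, B x -> complex_sphere (f x) &
      forall (j : 'F_p) x, B x -> f (box_act j x) = sphere_act j (f x)].

(* Main.v *)
(* Let c have no zero-sum hyperedge, and push x in B(H) forward along c to the
   masses y(a, i) of the cells (a, i) of Z/p x Z/p. The Fourier coefficients at the
   nontrivial characters turn translation of functions Y : Z/p -> C into the action
   on C^(p-1) and vanish only on constants, so it suffices to produce equivariantly
   from y a nonconstant Y, and then to normalize.
   The real part of Y is i |-> sum_a y(a, i). Suppose that it is constant; then
   every layer i is charged, so no choice of one charged cell per layer has colors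
   summing to 0, and by Cauchy-Davenport y charges at most 2p - 2 cells.
   The imaginary part distributes weights of the superlevel sets S of y with
   p <= |S| <= 2p - 2 among the labels in Z/p, the label of S being translated
   with S. The superlevel sets form a chain, so at most p - 1 labels are hit,
   while the support of y is hit: the imaginary part is not constant. *)
Require Import Defs.
From HB Require Import structures.
From mathcomp Require Import all_boot all_order all_algebra.
From mathcomp Require Import complex.
From mathcomp Require Import all_classical all_reals all_analysis.
From mathcomp Require Import zify ring.
Import Order.TTheory GRing.Theory Num.Theory.
Import numFieldNormedType.Exports.
Local Open Scope ring_scope.

(** * Cauchy-Davenport and zero-sum choices *)

Definition sumset {M : finZmodType} (A B : {set M}) : {set M} :=
  [set x + y | x in A, y in B]%SET.

(** Since [d] is invertible modulo [p], every x is reached from [a] by (x - a) / d steps of length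
    [d]. *)
Lemma stable_shift_Fp (p : nat) (A : {set 'F_p}) (a d : 'F_p) :
  d != 0 -> a \in A -> (forall x, x \in A -> x + d \in A) -> A = [set: 'F_p]%SET.
Proof.
move=> d0 aA Ad; apply/setP => x; rewrite inE.
have shift n : a + d *+ n \in A.
  elim: n => [|n IH]; first by rewrite mulr0n addr0.
  by rewrite mulrSr addrA Ad.
have -> : x = a + d *+ ((x - a) / d : 'F_p).
  by rewrite -mulr_natr natr_Zp mulrC divfK // addrC subrK.
exact: shift.
Qed.

(** Strong induction on [#|B|]. For a translate B' = e + B, the pair formed by the union and the
    intersection of A and B' has the same total size as (A, B), and its sumset lies in e + (A + B).
    A suitable e makes the intersection nonempty and smaller than B. *)
Lemma cauchy_davenport {p : nat} (p_prime : prime p) {A B : {set 'F_p}} :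
  (0 < #|A|)%N -> (0 < #|B|)%N -> (minn p (#|A| + #|B|).-1 <= #|sumset A B|)%N.
Proof.
move=> An0 Bn0; have [n] := ubnP #|B|.
elim: n A B An0 Bn0 => // n IH A B An0 Bn0 Bn.
have /card_gt0P[b bB] := Bn0.
have le1 : (#|A| <= #|sumset A B|)%N.
  rewrite -(card_imset A (addIr b)); apply/subset_leq_card/fintype.subsetP => x.
  by case/imsetP=> a aA ->; apply/imset2P; exists a b.
have [->|AT] := eqVneq A [set: 'F_p]%SET.
  have -> : sumset [set: 'F_p]%SET B = [set: 'F_p]%SET.
    apply/setP => x; rewrite inE; apply/imset2P; exists (x - b) b => //.
    by rewrite subrK.
  by rewrite cardsT card_Fp // geq_minl.
have [B1|B1] := leqP #|B| 1.
  apply: leq_trans (geq_minr _ _) _; apply: leq_trans le1; lia.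
have /card_gt1P[b1 [b2 [b1B b2B b12]]] := B1.
(* Dyson's e-transform of (A, B), with e = a - b1. *)
have [a aA aNA] : exists2 a, a \in A & a + (b2 - b1) \notin A.
  apply/exists_inP; apply: contraNT AT => /exists_inPn AS.
  have /card_gt0P[a aA] := An0; apply/eqP.
  apply: (@stable_shift_Fp p A a (b2 - b1)) => //.
    by rewrite subr_eq0 eq_sym.
  by move=> x /AS /negbNE.
pose B' := [set a - b1 + y | y in B]%SET.
have cB' : #|B'| = #|B| by apply: card_imset; apply: addrI.
have aB' : a \in B' by apply/imsetP; exists b1 => //; rewrite subrK.
have cUI := cardsUI A B'.
have In0 : (0 < #|A :&: B'|)%N by apply/card_gt0P; exists a; rewrite inE aA.
have Un0 : (0 < #|A :|: B'|)%N by apply/card_gt0P; exists a; rewrite inE aA.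
have IB : (#|A :&: B'| < #|B|)%N.
  rewrite -cB'; apply/proper_card/properP; split; first exact: finset.subsetIr.
  exists (a + (b2 - b1)); last by rewrite inE (negbTE aNA).
  by apply/imsetP; exists b2 => //; ring.
have := IH _ _ Un0 In0 (leq_trans IB Bn).
rewrite cUI cB' => /leq_trans; apply.
have -> : #|sumset A B| = #|[set a - b1 + y | y in sumset A B]%SET|.
  by rewrite card_imset //; apply: addrI.
apply/subset_leq_card/fintype.subsetP => s /imset2P[x y].
rewrite !inE => /orP[xA|xB] /andP[yA yB] ->.
  have /imsetP[z zB ->] := yB; apply/imsetP; exists (x + z); last by ring.
  by apply/imset2P; exists x z.
have /imsetP[z zB ->] := xB; apply/imsetP; exists (y + z); last by ring.
by apply/imset2P; exists y z.
Qed.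

Lemma big_sumsetP {M : finZmodType} (I : eqType) (s : seq I) (C : I -> {set M}) x :
  uniq s -> x \in \big[sumset/[set 0]%SET]_(i <- s) C i ->
  exists2 a : I -> M, {in s, forall i, a i \in C i} & x = \sum_(i <- s) a i.
Proof.
elim: s x => [|j s IH] x /=.
  by rewrite !big_nil inE => _ /eqP ->; exists (fun _ => 0); rewrite ?big_nil.
case/andP=> js us; rewrite big_cons => /imset2P[y z yC /(IH _ us)[a aC ->] ->].
exists (fun i => if i == j then y else a i).
  by move=> i; rewrite inE; case: eqVneq => [->|_] //= /aC.
rewrite big_cons eqxx; congr (_ + _); rewrite !big_seq.
by apply: eq_bigr => i is_; case: eqVneq => // ij; rewrite -ij is_ in js.
Qed.

(** Each further summand contributes at least [#|C i|.-1] new elements until the group is full. *)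
Lemma cauchy_davenport_big (p : nat) (p_prime : prime p) (I : Type) (s : seq I)
    (C : I -> {set 'F_p}) : (forall i, 0 < #|C i|)%N ->
  (minn p (\sum_(i <- s) #|C i|.-1).+1 <=
     #|\big[sumset/[set 0%R]%SET]_(i <- s) C i|)%N.
Proof.
move=> Cn0; elim: s => [|j s IH]; first by rewrite !big_nil cards1 geq_minr.
rewrite !big_cons; set S := \big[_/_]_(i <- s) C i in IH *.
have p0 := prime_gt0 p_prime.
have Sn0 : (0 < #|S|)%N by apply: leq_trans IH; rewrite leq_min p0.
apply: leq_trans (cauchy_davenport p_prime (Cn0 j) Sn0).
move: IH (Cn0 j); move: #|C j| #|S| (\sum_(i <- s) _)%N; lia.
Qed.

(** There are p sets, so 1 + sum (|C i| - 1) = 1 + sum |C i| - p >= p: the iterated sumset is all of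
    Z/p and contains 0. *)
Lemma zero_sum_choice (p : nat) (p_prime : prime p) (C : 'F_p -> {set 'F_p}) :
  (forall i, 0 < #|C i|)%N -> (p.*2.-1 <= \sum_i #|C i|)%N ->
  exists2 a : 'F_p -> 'F_p, forall i, a i \in C i & \sum_i a i = 0.
Proof.
move=> Cn0 big; have p0 := prime_gt0 p_prime.
have := @cauchy_davenport_big p p_prime _ (index_enum 'F_p) C Cn0.
have sumC : (\sum_i #|C i| = \sum_i #|C i|.-1 + p)%N.
  transitivity (\sum_i #|C i|.-1 + #|'F_p|)%N; last by rewrite card_Fp.
  rewrite -sum1_card -big_split /=.
  by apply: eq_bigr => i _; rewrite addn1 prednK.
rewrite (minn_idPl _); last first.
  move: big; rewrite sumC; move: (\sum_i _)%N p0 => n; lia.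
set S := \big[_/_]_(i <- _) _ => pS.
have /big_sumsetP : 0 \in S.
  have /eqP -> : S == [set: 'F_p]%SET.
    by rewrite eqEcard finset.subsetT cardsT card_Fp.
  by rewrite inE.
case=> [|a aC a0]; first exact: index_enum_uniq.
by exists a => // i; rewrite aC ?mem_index_enum.
Qed.

(** * Weights of superlevel sets *)

(* Nonzero exactly for the superlevel sets of y on which y is positive; a
   continuous substitute for the coordinates of barycentric subdivision. *)
Definition chain_weight {R : realType} {T : finType} (y : T -> R) (S : {set T}) : R :=
  (\prod_(s in S) y s) *
  \prod_(s in S) \prod_(r | r \notin S) Num.max 0 (y s - y r).

Section ChainWeight.
Context {R : realType} {T : finType}.
Implicit Types (y : T -> R) (S : {set T}).

Lemma chain_weight_ge0 y S : (forall t, 0 <= y t) -> 0 <= chain_weight y S.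
Proof.
move=> y0; apply: mulr_ge0; first exact: prodr_ge0.
by apply: prodr_ge0 => s _; apply: prodr_ge0 => r _; rewrite le_max lexx.
Qed.

Lemma chain_weight_lt {y S s r} :
  chain_weight y S != 0 -> s \in S -> r \notin S -> y r < y s.
Proof.
move=> /[swap] sS /[swap] rS; apply: contra_neqT; rewrite -leNgt => le_sr.
apply/eqP; rewrite mulf_eq0; apply/orP; right.
by rewrite (bigD1 s sS) /= (bigD1 r rS) /= max_l ?mul0r ?eqxx // subr_le0.
Qed.

(** An s in S outside S' and an r in S' outside S would give both y r < y s and y s < y r. *)
Lemma chain_weight_total {y S S'} : chain_weight y S != 0 ->
  chain_weight y S' != 0 -> (S \subset S') || (S' \subset S).
Proof.
move=> wS wS'; apply/norP => -[/subsetPn[s sS sS'] /subsetPn[r rS' rS]].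
have := lt_trans (chain_weight_lt wS sS rS) (chain_weight_lt wS' rS' sS').
by rewrite ltxx.
Qed.

(** Off the support y vanishes, so every difference in the product is a positive value of y. *)
Lemma chain_weight_support y : (forall t, 0 <= y t) ->
  0 < chain_weight y [set t | y t != 0]%SET.
Proof.
move=> y0; have pos t : y t != 0 -> 0 < y t by rewrite lt_def y0 andbT.
apply: mulr_gt0; first by apply: prodr_gt0 => t; rewrite inE => /pos.
apply: prodr_gt0 => s; rewrite inE => /pos ys.
apply: prodr_gt0 => r; rewrite inE negbK => /eqP ->.
by rewrite subr0 lt_max ys orbT.
Qed.

Lemma chain_weight_reindex (f : T -> T) y S :
  injective f -> chain_weight y (f @: S)%SET = chain_weight (y \o f) S.
Proof.
move=> f_inj; have bij := injF_bij f_inj.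
have fin s : (f s \in (f @: S)%SET) = (s \in S) by rewrite mem_imset.
rewrite /chain_weight !big_imset /=; try by move=> ? ? _ _ /f_inj.
congr (_ * _); apply: eq_bigr => s _.
rewrite (reindex f) /=; last exact: onW_bij.
by apply: eq_bigl => r; rewrite fin.
Qed.

End ChainWeight.

(** * Translation-compatible labels of sets of cells *)

Section Labels.
Context {p : nat} (p_prime : prime p).
Local Notation cell := {set 'F_p * 'F_p}.

(** The only multiple of p between p and 2p - 2 is p itself. At that size |S| is 0 in Z/p, so the
    color sum replaces it as denominator of the label and must be nonzero. *)
Definition labelled (S : cell) : bool :=
  (p <= #|S| <= p.*2.-2)%N && ((#|S| == p) ==> (\sum_(s in S) s.1 != 0)).

(* Translating the layers by j adds j * sum a, resp. j * |S|, to the numerator;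
   the denominator is nonzero in Z/p as soon as S is labelled. *)
Definition label (S : cell) : 'F_p :=
  if #|S| == p then (\sum_(s in S) s.1 * s.2) / \sum_(s in S) s.1
  else (\sum_(s in S) s.2) / #|S|%:R.

Lemma box_vertex_act_inj (V : finType) (j : 'F_p) :
  injective (@box_vertex_act p V j).
Proof.
move=> [a i] [b k] e; congr pair; first exact: (congr1 fst e).
exact: addIr (congr1 snd e).
Qed.

Local Notation shift j S := (@box_vertex_act p _ j @: S)%SET.

Lemma card_shift j (S : cell) : #|shift j S| = #|S|.
Proof. by rewrite card_imset //; apply: box_vertex_act_inj. Qed.

Lemma big_shift (j : 'F_p) (S : cell) (F : 'F_p * 'F_p -> 'F_p) :
  \sum_(s in shift j S) F s = \sum_(s in S) F (box_vertex_act j s).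
Proof. by rewrite big_imset //= => x y _ _; apply: box_vertex_act_inj. Qed.

Lemma labelled_shift j (S : cell) : labelled (shift j S) = labelled S.
Proof. by rewrite /labelled card_shift big_shift. Qed.

Lemma label_shift j (S : cell) :
  labelled S -> label (shift j S) = label S + j.
Proof.
rewrite /labelled /label card_shift !big_shift /box_vertex_act /=.
case: eqP => [_|/eqP Sp] /andP[/andP[pS Sle]] /=.
  move=> S0; under eq_bigr do rewrite mulrDr.
  by rewrite big_split /= -mulr_suml mulrDl (mulrAC _ j) mulfV // mul1r.
move=> _; rewrite big_split /= sumr_const mulrDl -[j *+ _]mulr_natr mulfK //.
rewrite -(dvdn_pcharf (pchar_Fp p_prime)); apply/negP => /dvdnP[q Sq].
by move: pS Sle Sp (prime_gt0 p_prime); rewrite Sq; case: q {Sq} => [|[|q]]; nia.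
Qed.

Definition chain_label {R : realType} (y : 'F_p * 'F_p -> R) (k : 'F_p) : R :=
  \sum_(S : cell | labelled S && (label S == k)) chain_weight y S.

(** Reindexing the sets by translation by j undoes the translation inside the weight, and turns the
    condition on the label from label S + j = k into label S = k - j. *)
Lemma chain_label_shift {R : realType} (y : 'F_p * 'F_p -> R) (j k : 'F_p) :
  chain_label (y \o box_vertex_act (- j)) k = chain_label y (k - j).
Proof.
rewrite /chain_label (reindex_inj (imset_inj (@box_vertex_act_inj _ j))).
apply: eq_big => [S|S _].
  rewrite labelled_shift; case: (boolP (labelled S)) => //= lS.
  by rewrite label_shift // -subr_eq opprK // [in RHS]eq_sym subr_eq eq_sym.
rewrite chain_weight_reindex; last exact: box_vertex_act_inj.
congr chain_weight; apply/funext => -[a i].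
by rewrite /= /box_vertex_act /= addrK.
Qed.

Lemma chain_label_not_constant {R : realType} (y : 'F_p * 'F_p -> R) :
  (forall s, 0 <= y s) -> labelled [set s | y s != 0]%SET ->
  exists k k', chain_label y k != chain_label y k'.
Proof.
move=> y0 lab; set S0 := [set s | _]%SET in lab.
pose G := [set S : cell | labelled S && (chain_weight y S != 0)]%SET.
have p0 := prime_gt0 p_prime.
have Gp : (#|G| < p)%N.
  suff : (#|G| <= p.-1)%N by lia.
  (* Members of a chain are determined by their sizes, and the sizes of labelled sets lie among the
     p - 1 integers p, ..., 2p - 2. *)
  rewrite cardE -(size_map (fun S : cell => #|S|)) -(size_iota p p.-1).
  apply: uniq_leq_size.
    rewrite map_inj_in_uniq ?enum_uniq // => S S'.
    rewrite !mem_enum !inE => /andP[_ wS] /andP[_ wS'] eqS.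
    apply/eqP; have /orP[sub|sub] := chain_weight_total wS wS'.
      by rewrite eqEcard sub eqS /=.
    by rewrite eq_sym eqEcard sub eqS /=.
  move=> n /mapP[S]; rewrite mem_enum inE => /andP[/andP[/andP[pS Sp] _] _] ->.
  rewrite mem_iota pS /=; move: Sp; move: #|S| => m; lia.
have /subsetPn[k _ kG] : ~~ ([set: 'F_p] \subset label @: G)%SET.
  apply/negP => /subset_leq_card; rewrite cardsT card_Fp // => pG.
  by have := leq_ltn_trans (leq_trans pG (leq_imset_card _ _)) Gp; rewrite ltnn.
exists (label S0), k.
have -> : chain_label y k = 0.
  apply: big1 => S /andP[lS /eqP lk]; apply: contraNeq kG => wS.
  by apply/imsetP; exists S => //; rewrite inE lS.
rewrite gt_eqF // /chain_label (bigD1 S0) ?lab ?eqxx //=.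
apply: ltr_wpDr; last exact: chain_weight_support.
by apply: sumr_ge0 => S _; apply: chain_weight_ge0.
Qed.

End Labels.

(** * Fourier transform on Z/p *)

Section Fourier.
Context {R : realType} {p : nat} (p_prime : prime p).
Local Notation C := R[i]%C.
Local Notation omega := (zp_omega R p).

Lemma ltn_Fp (i : 'F_p) : (i < p)%N.
Proof. by have := ltn_ord i; rewrite [X in (_ < X)%N -> _]Fp_cast. Qed.

Lemma dvdn_Fp (i : 'F_p) : (p %| i)%N = (i == 0).
Proof. by rewrite /dvdn modn_small ?ltn_Fp. Qed.

Lemma de_moivre (a : R) n :
  ((cos a +i* sin a)%C : C) ^+ n = (cos (a *+ n) +i* sin (a *+ n))%C.
Proof.
elim: n => [|n IH]; first by rewrite expr0 mulr0n cos0 sin0.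
rewrite exprS IH mulrS cosD sinD; simpc.
by congr (_ +i* _)%C; rewrite addrC [cos a * _]mulrC [X in _ + X]mulrC.
Qed.

Lemma normc_omega : `|omega| = 1.
Proof. by rewrite normc_def /= cos2Dsin2 sqrtr1. Qed.

(** The order divides the prime p. Order 1 would give cos (2 pi / p) = 1, although cos decreases
    strictly on [0, pi], which contains 2 pi / p > 0 because p >= 2. *)
Lemma omega_prim : p.-primitive_root omega.
Proof.
have p0 := prime_gt0 p_prime; have p1 := prime_gt1 p_prime.
have pR : p%:R != 0 :> R by rewrite pnatr_eq0 -lt0n.
have ompow : omega ^+ p = 1.
  rewrite de_moivre -[_ *+ p]mulr_natr divfK //.
  by rewrite mulr_natl cos2pi sin2pi.
have [m m_prim m_dvd] := prim_order_exists p0 ompow.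
have /orP[/eqP m1|/eqP mp] := (primeP p_prime).2 _ m_dvd; last first.
  by rewrite -[in X in X.-primitive_root]mp.
have /eqP : omega = 1 by rewrite -(prim_expr_order m_prim) m1 expr1.
rewrite eq_complex /= => /andP[/eqP cos1 _]; exfalso.
have : cos (2 * pi / p%:R) < cos (0 : R).
  rewrite ltr_cos ?in_itv /= ?lexx ?pi_ge0 //.
    by rewrite divr_gt0 ?mulr_gt0 ?pi_gt0 ?ltr0n.
  rewrite divr_ge0 ?mulr_ge0 ?pi_ge0 ?ler0n //= ler_pdivrMr ?ltr0n //.
  by rewrite mulrC ler_pM2l ?pi_gt0 // ler_nat.
by rewrite cos1 cos0 ltxx.
Qed.

(** The representative of [i + j] is congruent modulo p to the sum of the representatives, and
    exponents of [omega] count only modulo p. *)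
Lemma omega_expD (k : nat) (i j : 'F_p) :
  omega ^+ (k * (i + j)%R) = omega ^+ (k * i) * omega ^+ (k * j).
Proof.
rewrite -exprD -mulnDr; apply/eqP; rewrite (eq_prim_root_expr omega_prim).
have -> : ((i + j)%R : nat) = ((i + j) %% p)%N.
  by rewrite /= [X in (_ %% X)%N]Fp_cast.
by rewrite modnMmr.
Qed.

(** Multiplication by omega^k shifts the index by 1 and so fixes the sum, while omega^k differs from
    1. *)
Lemma omega_geometric (k : nat) : ~~ (p %| k)%N ->
  \sum_(i : 'F_p) omega ^+ (k * i) = 0.
Proof.
move=> pk; set s := \sum_i _.
have om1 : omega ^+ (k * (1%R : 'F_p)) - 1 != 0.
  rewrite subr_eq0 -(prim_order_dvd omega_prim) Euclid_dvdM // negb_or pk /=.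
  by rewrite /= Fp_cast // modn_small ?prime_gt1 // dvdn1 neq_ltn prime_gt1 ?orbT.
apply/eqP; rewrite -(mulrI_eq0 _ (mulfI om1)) mulrBl mul1r subr_eq0.
rewrite mulr_sumr; apply/eqP.
under eq_bigr do rewrite -omega_expD.
by rewrite [RHS](reindex_inj (addrI (1 : 'F_p))).
Qed.

Definition fourier (Y : 'F_p -> C) (k : nat) : C :=
  \sum_(i : 'F_p) omega ^+ (k * i) * Y i.

Lemma fourier_shift (Y : 'F_p -> C) (k : nat) (j : 'F_p) :
  fourier (fun i => Y (i - j)) k = omega ^+ (k * j) * fourier Y k.
Proof.
rewrite /fourier mulr_sumr [LHS](reindex_inj (addIr j)).
by apply: eq_bigr => i _; rewrite addrK omega_expD mulrA [_ * omega ^+ (k * j)]mulrC.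
Qed.

(** Fourier inversion writes p * Y l as a sum over all characters; only the trivial one survives,
    and its term does not depend on l. A nonzero k in Z/p corresponds to the row index k - 1. *)
Lemma fourier_eq0 (Y : 'F_p -> C) :
  (forall k : 'I_p.-1, fourier Y k.+1 = 0) -> forall i j, Y i = Y j.
Proof.
move=> Y0.
have inv (l : 'F_p) : \sum_(k : 'F_p) omega ^+ (k * (- l)%R) * fourier Y k =
    p%:R * Y l.
  under eq_bigr => k _ do rewrite /fourier mulr_sumr.
  rewrite exchange_big (bigD1 l) // -[RHS]addr0; congr (_ + _); last first.
    apply: big1 => i il.
    under eq_bigr do rewrite mulrA -omega_expD mulnC.
    rewrite -mulr_suml omega_geometric ?mul0r //.
    by rewrite dvdn_Fp addrC subr_eq0.
  under eq_bigr do rewrite mulrA -omega_expD addNr muln0 expr0 mul1r.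
  by rewrite sumr_const card_Fp // mulr_natl.
have inv0 (l : 'F_p) : p%:R * Y l = fourier Y 0.
  rewrite -inv (bigD1 0) //= mul0n expr0 mul1r big1 ?addr0 // => k.
  rewrite -val_eqE /= -lt0n => k0.
  have kp : (k.-1 < p.-1)%N.
    by have := ltn_Fp k; lia.
  by have := Y0 (Ordinal kp); rewrite /= prednK // => ->; rewrite mulr0.
have pC : p%:R != 0 :> C by rewrite pnatr_eq0 -lt0n prime_gt0.
by move=> i j; apply: (mulfI pC); rewrite !inv0.
Qed.

End Fourier.

(** * Continuity of elementary maps *)

Section Continuity.
Context {R : realType}.
Local Notation C := (R[i]%C^o).

Lemma continuous_real_complex : continuous (fun a : R => (a%:C)%C : C).
Proof.
move=> a; apply/cvgrPdist_lt => /= e.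
(* The order on [R[i]] is partial: a positive radius has zero imaginary part. *)
rewrite ltcE /= => /andP[/eqP ime re0].
near=> b; rewrite -rmorphB normc_def /= expr0n addr0 sqrtr_sqr ltcE /= -ime eqxx /=.
near: b; exact: (@cvgrPdist_lt _ _ _ _ _ _ _).1.
Unshelve. all: by end_near. Qed.

Lemma continuous_Re : continuous (fun z : C => complex.Re z : R).
Proof.
move=> z; apply/(@cvgrPdist_lt _ _ C (nbhs (z : C)) (nbhs_filter (z : C))) => /= e e0.
near=> w; rewrite -raddfB -ltcR.
apply: le_lt_trans (normc_ge_Re _) _.
near: w.
by exists (e%:C)%C; rewrite /= ?ltcR // => w; rewrite /= /ball_ => /=.
Unshelve. all: by end_near. Qed.

(** A neighbourhood of a row contains a product of neighbourhoods of its finitely many entries. *)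
Lemma continuous_rV {T : topologicalType} {U : topologicalType} {n : nat}
    (f : T -> 'rV[U]_n) (x : T) :
  (forall k, {for x, continuous (fun t => f t ord0 k)}) -> {for x, continuous f}.
Proof.
move=> fc A [P fxP sPA].
have : \forall t \near x, forall k, P ord0 k (f t ord0 k).
  by apply: filter_forall => k; apply: fc; apply: fxP.
rewrite /nbhs /=; apply: filterS => t Pt; apply: sPA => i j.
by rewrite (ord1 i); apply: Pt.
Qed.

Lemma continuous_sum {T : topologicalType} {K : numFieldType} {V : normedModType K}
  {I : Type} (r : seq I) (P : pred I) (g : I -> T -> V) :
  (forall i, P i -> continuous (g i)) ->
  continuous (fun x => \sum_(i <- r | P i) g i x).
Proof. by move=> gc; apply: continuous_big => //; apply: add_continuous. Qed.

Lemma continuous_prod {T : topologicalType} {K : numFieldType}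
  {I : Type} (r : seq I) (P : pred I) (g : I -> T -> K) :
  (forall i, P i -> continuous (g i)) ->
  continuous (fun x => \prod_(i <- r | P i) g i x).
Proof. by move=> gc; apply: continuous_big => //; apply: mul_continuous. Qed.

End Continuity.

(** * Radial projection onto the Euclidean sphere *)

Section Normalize.
Context {R : realType} {n : nat}.
Local Notation C := (R[i]%C^o).
Implicit Types z : 'rV[C]_n.

(** The modulus on [R[i]] takes its values in [R[i]]; [complex.Re] brings its square to R without
    loss, so that a real square root can be taken. *)
Definition euclidean_norm z : R :=
  Num.sqrt (\sum_k complex.Re (`|z ord0 k| ^+ 2)).

Definition normalize z : 'rV[C]_n :=
  \row_k (((euclidean_norm z)^-1)%:C%C * z ord0 k).

Lemma Re_sqr_normc (w : R[i]%C) :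
  ((complex.Re (`|w| ^+ 2))%:C)%C = `|w| ^+ 2 :> R[i]%C.
Proof. by rewrite RRe_real // realX // normr_real. Qed.

Lemma Re_sqr_normc_ge0 (w : R[i]%C) : 0 <= complex.Re (`|w| ^+ 2).
Proof. by rewrite -ler0c Re_sqr_normc exprn_ge0. Qed.

Lemma sqr_euclidean_norm z :
  (((euclidean_norm z) ^+ 2)%:C)%C = \sum_k `|z ord0 k| ^+ 2 :> R[i]%C.
Proof.
rewrite sqr_sqrtr; last by apply: sumr_ge0 => k _; apply: Re_sqr_normc_ge0.
by rewrite rmorph_sum /=; apply: eq_bigr => k _; rewrite Re_sqr_normc.
Qed.

Lemma euclidean_norm_neq0 z : z != 0 -> euclidean_norm z != 0.
Proof.
apply: contra_neq => z0; apply/rowP => k; rewrite mxE.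
have := sqr_euclidean_norm z; rewrite z0 expr0n /= => /esym/eqP.
rewrite psumr_eq0 => [/allP /(_ k)|i _]; last exact: exprn_ge0.
by rewrite mem_index_enum expf_eq0 normr_eq0 /= => /(_ isT)/eqP.
Qed.

Lemma normalize_sphere z : z != 0 -> complex_sphere (normalize z).
Proof.
move=> /euclidean_norm_neq0 N0; rewrite /complex_sphere /=.
under eq_bigr do rewrite mxE normrM exprMn.
rewrite -mulr_sumr -sqr_euclidean_norm normc_def /= expr0n addr0 sqrtr_sqr.
by rewrite -rmorphXn -rmorphM /= real_normK ?num_real // -exprMn mulVf ?expr1n.
Qed.

Lemma continuous_normalize z : z != 0 -> {for z, continuous normalize}.
Proof.
move=> /euclidean_norm_neq0 N0; apply: continuous_rV => k.
have coord j : continuous (fun w : 'rV[C]_n => w ord0 j) by apply: coord_continuous.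
have Nc : continuous euclidean_norm.
  move=> w; apply: (@continuous_comp _ _ _
    (fun w : 'rV[C]_n => \sum_j complex.Re (`|w ord0 j| ^+ 2)));
    last exact: sqrt_continuous.
  apply: (@continuous_sum _ R R) => j _ {}w.
  apply: (@continuous_comp _ C _ (fun w : 'rV[C]_n => `|w ord0 j| ^+ 2));
    last exact: continuous_Re.
  apply: (@continuousM R[i]%C _ (fun w : 'rV[C]_n => `|w ord0 j|)
    (fun w : 'rV[C]_n => `|w ord0 j|)); apply: (@continuous_comp _ C C _ Num.norm);
    try exact: coord; exact: (@norm_continuous _ C).
rewrite (_ : (fun t => _) =
  fun t => ((euclidean_norm t)^-1)%:C%C * t ord0 k); last first.
  by apply/funext => t; rewrite mxE.
apply: (@continuousM R[i]%C _ (fun t => ((euclidean_norm t)^-1)%:C%C)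
  (fun t : 'rV[C]_n => t ord0 k)); last exact: coord.
apply: (@continuous_comp _ R C (fun t => (euclidean_norm t)^-1));
  last exact: continuous_real_complex.
by apply: (@continuousV R) => //; apply: Nc.
Qed.

End Normalize.

Lemma normalize_sphere_act {R : realType} {p : nat} (j : 'F_p)
    (z : 'rV[R[i]%C^o]_p.-1) :
  normalize (sphere_act j z) = sphere_act j (normalize z).
Proof.
have norm_act : euclidean_norm (sphere_act j z) = euclidean_norm z.
  congr Num.sqrt; apply: eq_bigr => k _.
  by rewrite mxE normrM normrX normc_omega expr1n mul1r.
by apply/rowP => k; rewrite !mxE norm_act mulrCA.
Qed.

(** * The test function on Z/p and its nonconstancy *)

Lemma sum_pair_swap {M : nmodType} {I J : finType} (F : I * J -> M) :
  \sum_s F s = \sum_j \sum_i F (i, j).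
Proof. by rewrite exchange_big pair_bigA; apply: eq_bigr => -[]. Qed.

(** Nonempty layers give |S| >= p, and 2p - 1 cells would allow a zero-sum choice. If |S| = p, each
    layer has exactly one cell, so S is the graph of a choice and its color sum is nonzero by
    hypothesis. *)
Lemma labelled_of_no_zero_sum {p : nat} (p_prime : prime p)
    (S : {set 'F_p * 'F_p}) :
  (forall i, exists a, (a, i) \in S) ->
  (forall a : 'F_p -> 'F_p, (forall i, (a i, i) \in S) -> \sum_i a i != 0) ->
  labelled S.
Proof.
move=> Sfull Sn0; pose C (i : 'F_p) : {set 'F_p} := [set a | (a, i) \in S]%SET.
have Cn0 i : (0 < #|C i|)%N.
  by have [a aS] := Sfull i; apply/card_gt0P; exists a; rewrite inE.
have cardS : #|S| = (\sum_i #|C i|)%N.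
  rewrite -sum1_card (partition_big snd predT) //=; apply: eq_bigr => i _.
  rewrite sum1dep_card -(card_imset (C i) (f := fun a => (a, i)));
    last by move=> a b [].
  apply: eq_card => -[a k]; rewrite inE; apply/andP/imsetP => /=.
    by case=> aS /eqP ki; exists a; rewrite ?inE -ki.
  by case=> b; rewrite inE => bS [-> ->].
have Sp : (p <= #|S|)%N.
  rewrite cardS -[X in (X <= _)%N](card_Fp p_prime) -sum1_card.
  exact: leq_sum.
have [Slt|Sge] := ltnP #|S| p.*2.-1; last first.
  rewrite cardS in Sge; have [a aC a0] := zero_sum_choice p p_prime C Cn0 Sge.
  have : \sum_i a i != 0 by apply: Sn0 => i; have := aC i; rewrite inE.
  by rewrite a0 eqxx.
rewrite /labelled Sp /=; apply/andP; split.
  by move: Slt; move: #|S| => m; lia.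
apply/implyP => /eqP Scard.
(* The default 0 is never taken, because every layer is nonempty. *)
pose a i : 'F_p := odflt 0 [pick a in C i].
have aS i : (a i, i) \in S.
  rewrite /a; case: pickP => [b|C0]; first by rewrite inE.
  by have := Cn0 i; rewrite (eq_card0 C0).
pose g i := (a i, i).
have g_inj : injective g by move=> i k /(congr1 snd).
have -> : S = (g @: [set: 'F_p])%SET.
  apply/eqP; rewrite eq_sym eqEcard card_imset // cardsT card_Fp //.
  rewrite Scard leqnn andbT.
  by apply/fintype.subsetP => s /imsetP[i _ ->]; apply: aS.
rewrite big_imset /=; last by move=> i k _ _; apply: g_inj.
by rewrite (eq_bigl predT) => [|i]; [apply: Sn0 | rewrite inE].
Qed.

Definition test_map {R : realType} {p : nat} (y : 'F_p * 'F_p -> R) (i : 'F_p) :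
    R[i]%C :=
  ((\sum_a y (a, i)) +i* chain_label y i)%C.

Lemma test_map_shift {R : realType} {p : nat} (p_prime : prime p)
    (y : 'F_p * 'F_p -> R) (j i : 'F_p) :
  test_map (y \o box_vertex_act (- j)) i = test_map y (i - j).
Proof. by rewrite /test_map chain_label_shift. Qed.

Lemma test_map_not_constant {R : realType} {p : nat} (p_prime : prime p)
    (y : 'F_p * 'F_p -> R) :
  (forall s, 0 <= y s) -> \sum_s y s = 1 ->
  (forall a : 'F_p -> 'F_p, (forall i, y (a i, i) != 0) -> \sum_i a i != 0) ->
  ~ (forall i j, test_map y i = test_map y j).
Proof.
move=> y0 y1 no0 const.
have const_sum i j : \sum_a y (a, i) = \sum_a y (a, j).
  exact: (congr1 (@complex.Re R) (const i j)).
have const_label i j : chain_label y i = chain_label y j.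
  exact: (congr1 (@complex.Im R) (const i j)).
have lab : labelled [set s | y s != 0]%SET.
  apply: labelled_of_no_zero_sum => // [i|a aS]; last first.
    by apply: no0 => i; have := aS i; rewrite inE.
  (* An uncharged layer i has mass 0; by constancy all layers would have mass 0, against total mass
     1. *)
  have [a ya|all0] := pickP (fun a => y (a, i) != 0).
    by exists a; rewrite inE.
  have : \sum_s y s = 0.
    rewrite sum_pair_swap; apply: big1 => k _.
    rewrite (const_sum k i); apply: big1 => a _.
    by apply/eqP/negbFE/all0.
  by move/eqP; rewrite y1 oner_eq0.
have [k [k']] := chain_label_not_constant p_prime y y0 lab.
by rewrite (const_label k k') eqxx.
Qed.

(** * The equivariant map on the box complex *)

Section EquivariantMap.
Context {R : realType} {p : nat} {V : finType} (p_prime : prime p) (c : V -> 'F_p).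
Local Notation C := (R[i]%C^o).
Local Notation point := {ptws V * 'F_p -> R}.

Definition color_mass (x : point) (s : 'F_p * 'F_p) : R :=
  \sum_(v | c v == s.1) x (v, s.2).

Definition fourier_row (x : point) : 'rV[C]_p.-1 :=
  \row_k fourier (test_map (color_mass x)) k.+1.

Lemma fourier_row_act (j : 'F_p) (x : point) :
  fourier_row (box_act j x) = sphere_act j (fourier_row x).
Proof.
apply/rowP => k; rewrite !mxE -fourier_shift //; congr fourier; apply/funext => i.
exact: (test_map_shift p_prime (color_mass x)).
Qed.

Lemma fourier_row_neq0 (H : {set {set V}}) (x : point) :
  uniform_hypergraph p H -> (forall e, e \in H -> \sum_(v in e) c v != 0) ->
  realization (box_complex p H) x -> fourier_row x != 0.
Proof.
move=> Hunif no0 [x0 x1 xB]; apply/eqP => /rowP row0.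
have mass0 s : 0 <= color_mass x s by apply: sumr_ge0 => v _; apply: x0.
apply: (@test_map_not_constant R p p_prime (color_mass x)) => //.
- rewrite -x1 !sum_pair_swap; apply: eq_bigr => k _.
  by rewrite [RHS](partition_big c predT).
- move=> a amass.
  have pick i : exists v, (c v == a i) && (x (v, i) != 0).
    apply/existsP; apply: contraT => /existsPn none.
    have /eqP[] := amass i; apply: big1 => v cv.
    by apply/eqP; have := none v; rewrite cv /= negbK.
  have [v vP] := choice pick.
  have eH : [set finfun v i | i in 'F_p]%SET \in H.
    have := xB; rewrite inE => /forallP/(_ (finfun v))/implyP; apply.
    by apply/forallP => i; rewrite inE ffunE; case/andP: (vP i).
  (* The hyperedge is the image of [v] and has p elements, so [v] is injective and the sum over the
     hyperedge is a sum over the layers. *)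
  have := no0 _ eH; rewrite big_imset /=; last first.
    by apply/imset_injP; rewrite Hunif // card_Fp.
  congr (_ != 0); apply: eq_bigr => i _.
  by rewrite ffunE; case/andP: (vP i) => /eqP.
- by apply: fourier_eq0 => // k; have := row0 k; rewrite !mxE.
Qed.

Lemma color_mass_continuous s : continuous (fun x : point => color_mass x s).
Proof.
apply: (@continuous_sum _ R R) => v _.
exact: (@proj_continuous _ (fun _ => R)).
Qed.

(** The labels are attached to sets and do not vary with x; only the weights do, and these are
    products of masses and of truncated differences of masses. *)
Lemma chain_label_continuous k :
  continuous (fun x : point => chain_label (color_mass x) k).
Proof.
apply: (@continuous_sum _ R R) => S _ x; apply: continuousM.
  by apply: continuous_prod => s _; apply: color_mass_continuous.
apply: continuous_prod => s _; apply: continuous_prod => r _ {}x.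
apply: (@continuous_max _ _ (fun=> 0)
  (fun t : point => color_mass t s - color_mass t r)); first exact: cst_continuous.
by apply: continuousB; apply: color_mass_continuous.
Qed.

Lemma fourier_row_continuous : continuous fourier_row.
Proof.
move=> x; apply: continuous_rV => k.
rewrite (_ : (fun t => _) =
  fun t => fourier (test_map (color_mass t)) k.+1); last first.
  by apply/funext => t; rewrite mxE.
apply: (@continuous_sum _ R[i]%C C) => i _ {}x.
apply: (@continuousM R[i]%C _ (fun=> _)); first exact: cst_continuous.
rewrite (_ : (fun t => _) = fun t : point => (\sum_a color_mass t (a, i))%:C%C +
  'i%C * (chain_label (color_mass t) i)%:C%C); last first.
  by apply/funext => t; rewrite [LHS]complexE.
apply: (@continuousD R[i]%C C).
  apply: (@continuous_comp _ R C); last exact: continuous_real_complex.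
  by apply: (@continuous_sum _ R R) => a _; apply: color_mass_continuous.
apply: (@continuousM R[i]%C _ (fun=> 'i%C)); first exact: cst_continuous.
apply: (@continuous_comp _ R C); last exact: continuous_real_complex.
exact: chain_label_continuous.
Qed.

End EquivariantMap.

Theorem theorem1p1 (R : realType) (p : nat) (V : finType) (H : {set {set V}})
    (p_prime : prime p) (H_uniform : uniform_hypergraph p H) :
  ~ (exists f : {ptws V * 'F_p -> R} -> 'rV[R[i]%C^o]_p.-1,
       equivariant_map H f) ->
  forall c : V -> 'F_p,
    exists e : {set V}, e \in H /\ \sum_(v in e) c v = 0.
Proof.
move=> no_map c; apply: contrapT => no_edge; apply: no_map.
have no0 e : e \in H -> \sum_(v in e) c v != 0.
  by move=> eH; apply/eqP => sum0; apply: no_edge; exists e.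
exists (fun x => normalize (fourier_row c x)); split.
(* Normalization is continuous away from 0, and the Fourier row does not vanish on the box
   complex. *)
- apply: continuous_in_subspaceT => x /set_mem xB.
  apply: continuous_comp; first exact: fourier_row_continuous.
  exact/continuous_normalize/(fourier_row_neq0 p_prime c H).
- by move=> x xB; apply/normalize_sphere/(fourier_row_neq0 p_prime c H).
- by move=> j x _; rewrite fourier_row_act // normalize_sphere_act.
Qed.
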